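(* Let $\varepsilon$ be a real number with $0<\varepsilon<\frac{1}{4}$. Then there exists an integer $N=N(\varepsilon)$ such that every graph $G$ on $n\geq N$ vertices with $\rho(G)>\sqrt{\lfloor n^2/4\rfloor}$ contains a cycle $C_{\ell}$ for every integer $\ell \in [3,(\frac{1}{4}-\varepsilon)n]$.
   Context: $\rho(G)$ denotes the spectral radius (largest eigenvalue) of the adjacency matrix of $G$. *)

(* Defs.v *)
From HB Require Import structures.
From mathcomp Require Import all_boot all_order all_algebra.
From mathcomp Require Import boolp classical_sets reals.
Set Implicit Arguments.
Unset Strict Implicit.
Unset Printing Implicit Defensive.
Import Order.TTheory GRing.Theory Num.Theory.
Local Open Scope classical_set_scope.
Local Open Scope ring_scope.

(* A finite simple graph is a symmetric irreflexive adjacency relation        *)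
(* [e : rel T] on a finite vertex type [T].                                   *)

(* The vertices are numbered by their position in [enum T]; the spectrum does *)
(* not depend on this choice.                                                 *)
Definition adjacency_mx (R : realType) (T : finType) (e : rel T) :
    'M[R]_#|T| :=
  \matrix_(i, j) (e (enum_val i) (enum_val j))%:R.

(* The set of real eigenvalues is finite, and for a graph with at least one   *)
(* vertex it is nonempty (the matrix is symmetric), so its [sup] is its       *)
(* largest element. For the graph without vertices the value is [sup set0 = 0]. *)
Definition spectral_radius (R : realType) (T : finType) (e : rel T) : R :=
  sup [set x : R | eigenvalue (adjacency_mx R e) x].

(* [ucycle e c] says that the entries of [c] are distinct and cyclically      *)
(* adjacent; it also holds for some [c] of size 0 or 2 that are not graph     *)
(* cycles, hence the first conjunct.                                          *)
Definition has_cycle (T : finType) (e : rel T) (l : nat) : Prop :=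
  (2 < l)%N /\ exists c : seq T, size c = l /\ ucycle e c.

(* Main.v *)
(* If [y] is an eigenvector for [x], evaluating [M^2 y = x^2 y], with [M] the  *)
(* adjacency matrix, at a vertex [v] where [|y|] is largest shows that the    *)
(* degrees of the neighbours of [v] add up to more than [n^2/4].              *)
(* A cycle of length [l] through [v] is then a path on [l - 1] vertices that  *)
(* avoids [v] and has both ends in [N(v)].                                    *)
(* Among the disjoint pairs [A <= N(v)], [B] not containing [v] that still    *)
(* satisfy such a density condition, a minimal one is connected (ignoring     *)
(* edges inside [B]) and has an edge inside [A].  Let [d] be the average      *)
(* degree of [G[A]].  By Erdos-Gallai, [G[A]] contains a cycle [Z] with       *)
(* at least [max(2, d)] vertices, and the density condition leaves between    *)
(* [A] and [B] a bipartite core with degrees at least [n/4 - d - 2] on the    *)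
(* [A] side and [n/4] on the [B] side.  Start on [Z], follow a link to the    *)
(* core, and alternate greedily in the core: the arc of [Z] can have any      *)
(* length, which fixes the parity and makes up for the short alternating      *)
(* path when [d] is large.  If the link is longer than needed, truncate it:   *)
(* of two consecutive vertices of the link, one lies in [A].                  *)
Require Import Defs.
From HB Require Import structures.
From mathcomp Require Import all_boot all_order all_algebra.
From mathcomp Require Import reals.
From mathcomp Require Import zify lra.
Set Implicit Arguments.
Unset Strict Implicit.
Unset Printing Implicit Defensive.
Import Order.TTheory GRing.Theory Num.Theory.

Definition deg_in (T : finType) (e : rel T) (S : {set T}) (x : T) : nat :=
  #|[set y in S | e x y]|.

Definition inner_edge (T : finType) (e : rel T) (A B : {set T}) : rel T :=
  fun x y => [&& e x y, x \in A :|: B, y \in A :|: B & (x \in A) || (y \in A)].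

(* [maxn (n * m) (m.+1 ^ 2)] is the density threshold for a pair of sets of   *)
(* total size [m < n]: the linear term provides the degrees of the bipartite  *)
(* core, the quadratic one forces an edge inside the first set when [m] is    *)
(* almost [n], and superadditivity makes minimal dense pairs connected.       *)
Lemma threshold_superadd (n a b : nat) :
  (0 < a)%N -> (0 < b)%N -> (a + b < n)%N ->
  (maxn (n * a) (a.+1 ^ 2) + maxn (n * b) (b.+1 ^ 2)
     <= maxn (n * (a + b)) ((a + b).+1 ^ 2))%N.
Proof.
move=> a_gt0 b_gt0 ltn.
have sq (c d : nat) : (0 < c)%N -> (0 < d)%N -> (c + d < n)%N ->
    (c.+1 ^ 2 + n * d <= maxn (n * (c + d)) ((c + d).+1 ^ 2))%N.
  move=> c0 d0; rewrite leq_max; have [le|gt] := leqP (c + 3) n.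
    by move=> _; apply/orP; left; nia.
  by move=> cd; apply/orP; right; nia.
have [_|_] := leqP (a.+1 ^ 2) (n * a); have [_|_] := leqP (b.+1 ^ 2) (n * b).
- by rewrite leq_max mulnDr leqnn.
- by rewrite addnC [(a + b)%N]addnC; apply: sq => //; rewrite addnC.
- exact: sq.
- by rewrite leq_max; apply/orP; right; nia.
Qed.

(** Shares out the [l.-1] vertices of the cycle other than [v]: [j] on [Z], [c] on the link, [i.*2]
    alternating in the core. If more than [N] remain after the link, [j] is [N] or, for parity,
    [N - 1], positive since [N >= 2]. The last bound serves the [B] side, where the link occupies at
    most [c / 2] vertices. *)
Lemma split_length (n l d c : nat) :
  (d < l.-1)%N -> (4 * l + 4 <= n)%N -> (c.+1 < l.-1)%N ->
  exists j i, [/\ 0 < j, j <= maxn 2 d, j + c + i.*2 = l.-1 &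
    (i == 0) || (2 * c + 4 * i <= n - 4 * d - 8)]%N.
Proof.
move=> d_lt le_l c_lt; set N := maxn 2 d; pose r := (l.-1 - c)%N.
have [le_r|lt_r] := leqP r N; first by exists r, 0; split=> //; lia.
exists (N - odd (r - N))%N, (r - (N - odd (r - N)))./2; split; lia.
Qed.

Section Graph.

Variables (T : finType) (e : rel T).
Hypotheses (e_sym : symmetric e) (e_irr : irreflexive e).

Local Notation deg := (deg_in e).

(** * Degree sums and the Erdos-Gallai theorem on long cycles *)

Lemma deg_inE (S : {set T}) x : deg S x = \sum_(y in S) e x y.
Proof.
rewrite /deg_in -sum1_card [RHS]big_mkcond [LHS]big_mkcond /=.
by apply: eq_bigr => y _; rewrite inE; case: (y \in S); case: (e x y).
Qed.

Lemma deg_inID (S U : {set T}) x :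
  deg S x = (deg (S :&: U) x + deg (S :\: U) x)%N.
Proof. by rewrite !deg_inE (big_setID U). Qed.

Lemma sum_deg_inC (A B : {set T}) :
  \sum_(x in A) deg B x = \sum_(y in B) deg A y.
Proof.
under eq_bigr do rewrite deg_inE; rewrite exchange_big.
under [RHS]eq_bigr do rewrite deg_inE.
by apply: eq_bigr => y _; apply: eq_bigr => x _; rewrite e_sym.
Qed.

(* Let [U] be the set of ends of the paths obtained from a longest path by    *)
(* reordering its last [c] vertices.  Without a cycle longer than [c], every  *)
(* neighbour of [U] is among those [c] vertices, and by rotation [U] has at   *)
(* least as many elements as any of its elements has neighbours.  Hence       *)
(* deleting [U] decreases the degree sum by at most [c * #|U|]: induct.       *)
Lemma long_cycle_of_sum_deg (c : nat) (D : {set T}) :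
  (0 < c)%N -> (c * #|D| < \sum_(x in D) deg D x)%N ->
  exists z, [/\ ucycle e z, (c < size z)%N & {subset z <= D}].
Proof.
move=> c_gt0; have [m] := ubnP #|D|.
elim: m D => // m IHm D; rewrite ltnS => leDm dens.
pose st (s : seq T) := [&& uniq s, sorted e s & all [in D] s].
pose has_st k := [exists s : k.-tuple T, st s].
have D_gt0 : (0 < #|D|)%N.
  by rewrite lt0n; apply/eqP => /cards0_eq D0; move: dens; rewrite D0 big_set0 ltn0.
have ex_st : exists k, has_st k.
  case/card_gt0P: D_gt0 => x xD; exists 1; apply/existsP.
  by exists [tuple x]; rewrite /st /= xD.
have ub_st k : has_st k -> (k <= #|T|)%N.
  by case/existsP=> s /and3P[/card_uniqP us _ _]; rewrite -(size_tuple s) -us max_card.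
case: (ex_maxnP ex_st ub_st) => L /existsP[P stP] maxL.
have {}maxL s : st s -> (size s <= L)%N.
  by move=> sts; apply: maxL; apply/existsP; exists (in_tuple s).
have L_gt0 : (0 < L)%N.
  by case/card_gt0P: D_gt0 => x xD; apply: (maxL [:: x]); rewrite /st /= xD.
pose pre := take (L - c) P; pose t0 := drop (L - c) P.
have szP : size P = L by rewrite size_tuple.
have sz_t0 : size t0 = minn L c by rewrite size_drop szP; lia.
have szpre : size pre = (L - c)%N by rewrite size_takel // szP leq_subr.
pose isend b := [exists t : (size t0).-1.-tuple T,
  st (pre ++ rcons t b) && perm_eq (rcons t b) t0].
have isendP b t : st (pre ++ rcons t b) -> perm_eq (rcons t b) t0 -> isend b.
  move=> stt pt; have szt : size t == (size t0).-1.
    by rewrite -(perm_size pt) size_rcons.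
  by apply/existsP; exists (Tuple szt); rewrite /= stt pt.
pose U := [set b | isend b].
pose Q := [set x in t0].
have cardQ : (#|Q| <= c)%N.
  by rewrite cardsE (leq_trans (card_size _)) // sz_t0 geq_minr.
have UQ : U \subset Q.
  apply/subsetP=> b; rewrite !inE => /existsP[t /andP[_ pt]].
  by rewrite -(perm_mem pt) mem_rcons inE eqxx.
have UD : U \subset D.
  apply/subsetP=> b; rewrite !inE => /existsP[t /andP[/and3P[_ _ /allP sD] _]].
  by apply: sD; rewrite mem_cat mem_rcons inE eqxx orbT.
have U_gt0 : (0 < #|U|)%N.
  have: pre ++ t0 = P by rewrite cat_take_drop.
  case: (lastP t0) sz_t0 (@isendP) => [|t b]; first by move=> /=; lia.
  move=> _ isendP' PE; apply/card_gt0P; exists b; rewrite inE.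
  by apply: (isendP' b t) => //; rewrite PE.
(* An end in [U] adjacent to some [x] in [pre] closes a cycle through [x] and all of the last [c]
   vertices. *)
have [/existsP[b /andP[]]|noback] := boolP [exists b in U, has (e b) pre].
  rewrite inE => /existsP[t /andP[/and3P[]]] + + + pt /hasP[x xpre ebx].
  have szt : size (rcons t b) = c.
    rewrite (perm_size pt) sz_t0; move: xpre szpre.
    by case: (pre) => [//|? ?] _ /=; lia.
  case/splitPr: xpre => p1 p2.
  rewrite -catA cat_uniq sorted_cat_cons all_cat.
  case/and3P=> _ _ uz /andP[_ sz] /andP[_ /allP zD].
  exists ((x :: p2) ++ rcons t b); split => //; last by rewrite size_cat szt /=; lia.
  rewrite /ucycle uz andbT /= rcons_path last_cat last_rcons ebx andbT.
  exact: sz.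
have {}noback b x : b \in U -> e b x -> x \notin pre.
  move=> bU ebx; apply/negP => xpre; case/negP: noback; apply/existsP; exists b.
  by rewrite bU; apply/hasP; exists x.
have nbrQ b : b \in U -> [set x in D | e b x] \subset Q.
  move=> bU; apply/subsetP=> x; rewrite !inE => /andP[xD ebx].
  have xpre := noback b x bU ebx.
  move: bU; rewrite inE => /existsP[t /andP[stt pt]].
  apply: contraT => xt0; suff: (size (rcons (pre ++ rcons t b) x) <= L)%N.
    rewrite size_rcons size_cat (perm_size pt) szpre sz_t0; lia.
  case/and3P: stt => us ss sD; apply: maxL; apply/and3P; split.
  - by rewrite rcons_uniq us mem_cat (perm_mem pt) negb_or xpre xt0.
  - move: ss; rewrite -!rcons_cat; case: (pre ++ t) => [|y r] /=; first by rewrite ebx.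
    by rewrite [path e y (rcons (rcons _ _) _)]rcons_path last_rcons ebx andbT.
  - by rewrite all_rcons sD andbT.
have degU b : b \in U -> (deg D b <= #|U|)%N.
  move=> bU; have nbrQb := nbrQ b bU.
  have := bU; rewrite inE => /existsP[t /andP[stt pt]].
  pose r := rcons t b.
  (* Rotation: for a neighbour [x] of [b], reversing the part after [x] turns the successor of [x]
     into an end. So [nxt] maps the neighbours of [b] injectively into [U]. *)
  pose nxt x := nth b r (index x r).+1.
  have ur : uniq r by case/and3P: stt; rewrite cat_uniq => /and3P[].
  have idx x : x \in [set x in D | e b x] -> ((index x r).+1 < size r)%N.
    move=> xN; have := subsetP nbrQb x xN; rewrite inE -(perm_mem pt) => xr.
    have: (index x r < size r)%N by rewrite index_mem.
    rewrite leq_eqVlt => /predU1P[|//]; rewrite size_rcons => -[xlast].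
    have xb : x = b by rewrite -(nth_index b xr) xlast nth_rcons ltnn eqxx.
    by move: xN; rewrite inE xb e_irr andbF.
  rewrite /deg_in -(card_in_imset (f := nxt)); last first.
    move=> x y xN yN /eqP; rewrite (nth_uniq _ (idx x xN) (idx y yN) ur) eqSS => /eqP ixy.
    have xr : x \in r by rewrite -index_mem ltnW // idx.
    have yr : y \in r by rewrite -index_mem ltnW // idx.
    by rewrite -(nth_index b xr) ixy nth_index.
  apply/subset_leq_card/subsetP=> _ /imsetP[x xN ->].
  have xr : x \in r by rewrite -index_mem ltnW // idx.
  have ltx := idx x xN; rewrite /nxt.
  set i := index x r in ltx *; set y := nth b r i.+1.
  have rE : r = take i r ++ x :: drop i.+1 r.
    by rewrite -{1}(cat_take_drop i r) (drop_nth b) ?(ltnW ltx) // nth_index.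
  have dE : drop i.+1 r = y :: drop i.+2 r by rewrite (drop_nth b).
  have [w wE] : exists w, drop i.+1 r = rcons w b.
    exists (belast y (drop i.+2 r)); rewrite dE lastI; congr rcons.
    by move: (congr1 (last b) rE); rewrite last_rcons last_cat dE.
  have lastE : r = take i r ++ x :: rcons w b by rewrite -wE.
  have yhead : rev (rcons w b) = rcons (rev (drop i.+2 r)) y.
    by rewrite -wE dE rev_cons.
  rewrite inE; apply: (@isendP _ (take i r ++ x :: rev (drop i.+2 r))).
    rewrite rcons_cat /= -yhead.
    have pr : perm_eq (pre ++ (take i r ++ x :: rev (rcons w b))) (pre ++ r).
      by rewrite [X in perm_eq _ (pre ++ X)]lastE perm_cat2l perm_cat2l perm_cons perm_rev.
    case/and3P: stt => us ss sD; apply/and3P; split.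
    - by rewrite (perm_uniq pr).
    - move: ss; rewrite -/r {1}lastE !catA !sorted_cat_cons.
      case/andP=> -> pw; rewrite /= rev_rcons /=.
      have -> : e x b by move: xN; rewrite inE e_sym => /andP[].
      have := rev_path e x (rcons w b).
      rewrite belast_rcons last_rcons rev_cons rcons_path /=.
      rewrite (eq_path (e' := e)) ?pw; last by move=> u1 u2; rewrite e_sym.
      by case/andP.
    - by rewrite (eq_all_r (perm_mem pr)).
  rewrite rcons_cat /= -yhead.
  apply: perm_trans pt.
  by rewrite -/r [X in perm_eq _ X]lastE perm_cat2l perm_cons perm_rev.
(* Deleting [U] loses each edge between [U] and [D :\: U] from both ends, hence the second summand.
   Neighbours outside [U] lie in [Q :\: U]. *)
have loss : (\sum_(b in U) (deg D b + deg (D :\: U) b) <= c * #|U|)%N.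
  rewrite mulnC -sum_nat_const; apply: leq_sum => b bU.
  have -> : deg (D :\: U) b = #|[set x in D | e b x] :\: U|.
    by apply: eq_card => x; rewrite !inE; case: (isend x).
  apply: leq_trans cardQ; rewrite -(cardsID U Q) (setIidPr UQ).
  by rewrite leq_add ?degU // subset_leq_card // setSD // nbrQ.
have DU : D :&: U = U by apply/setIidPr.
have cardD : #|D| = (#|U| + #|D :\: U|)%N by rewrite -(cardsID U D) DU.
have [] := IHm (D :\: U); first by lia.
  have := dens; rewrite (big_setID U) /= DU.
  under [X in _ < _ + X]eq_bigr do rewrite (deg_inID D U) DU.
  rewrite big_split /= (sum_deg_inC (D :\: U) U) addnA -big_split /= cardD mulnDr.
  by move: loss; lia.
by move=> z [uz cz /subsetP zD]; exists z; split=> //; apply/subsetP/(subset_trans zD)/subsetDl.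
Qed.

(** * Bipartite cores, greedy paths and closing a cycle *)

(** Deleting a vertex that violates its degree bound lowers the left side at least as much as the
    right one. The strict inequality survives, so [A] never becomes empty. *)
Lemma bipartite_core (s t : nat) (A B : {set T}) :
  (s * #|A| + t * #|B| < 4 * \sum_(u in A) deg B u)%N ->
  exists A1 B1 : {set T}, [/\ A1 \subset A, B1 \subset B, A1 != set0,
    {in A1, forall u, s < 4 * deg B1 u}%N & {in B1, forall w, t < 4 * deg A1 w}%N].
Proof.
have [m] := ubnP (#|A| + #|B|); elim: m A B => // m IHm A B; rewrite ltnS => le_m dens.
have [/existsP[u /andP[uA du]]|/existsPn okA] :=
  boolP [exists u, (u \in A) && (4 * deg B u <= s)%N].
  have [||A1 [B1 [sA sB A1n0 dA dB]]] := IHm (A :\ u) B.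
  - by move: le_m; rewrite (cardsD1 u A) uA; lia.
  - by move: dens; rewrite (big_setD1 u) //= (cardsD1 u A) uA; lia.
  exists A1, B1; split=> //; exact: subset_trans sA (subsetDl _ _).
have [/existsP[w /andP[wB dw]]|/existsPn okB] :=
  boolP [exists w, (w \in B) && (4 * deg A w <= t)%N].
  have [||A1 [B1 [sA sB A1n0 dA dB]]] := IHm A (B :\ w).
  - by move: le_m; rewrite (cardsD1 w B) wB; lia.
  - move: dens; rewrite (sum_deg_inC A B) (sum_deg_inC A (B :\ w)).
    by rewrite (big_setD1 w) //= (cardsD1 w B) wB; lia.
  exists A1, B1; split=> //; exact: subset_trans sB (subsetDl _ _).
exists A, B; split=> //.
- by apply/eqP => A0; move: dens; rewrite A0 big_set0 muln0 ltn0.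
- by move=> u uA; have := okA u; rewrite uA ltnNge.
- by move=> w wB; have := okB w; rewrite wB ltnNge.
Qed.

(** Greedy choice: [X] collects the vertices to avoid, and each of the [i] rounds adds one vertex of
    either side to it. *)
Lemma alternating_path (A B : {set T}) (s t i : nat) (x : T) (X : {set T}) :
  [disjoint A & B] ->
  {in A, forall u, s <= deg B u}%N -> {in B, forall w, t <= deg A w}%N ->
  x \in A -> (#|X :&: B| + i <= s)%N -> (#|X :&: A| + i <= t)%N ->
  exists p, [/\ path e x p, size p = i.*2, uniq p, last x p \in A &
    {in p, forall y, (y \in A :|: B) && (y \notin X)}].
Proof.
move=> dAB degA degB; elim: i x X => [|i IHi] x X xA cB cA; first by exists [::].
have pick (S Y : {set T}) z : (#|Y :&: S| < deg S z)%N ->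
    exists y, [/\ y \in S, e z y & y \notin Y].
  move=> lt; have /subsetPn[y] : ~~ ([set y in S | e z y] \subset Y :&: S).
    by apply: contraL lt => /subset_leq_card; rewrite -leqNgt.
  by rewrite !inE => /andP[yS ezy]; rewrite yS andbT; exists y.
have [|w [wB exw wX]] := pick B X x; first by have := degA x xA; lia.
have [|a [aA ewa aX]] := pick A X w; first by have := degB w wB; lia.
have aB : a \notin B by apply: contraL aA => aB; rewrite (disjointFl dAB).
have wA : w \notin A by rewrite (disjointFl dAB).
have [||p [pp sp up lp pX]] := IHi a (w |: (a |: X)) aA.
- have -> : (w |: (a |: X)) :&: B = w |: (X :&: B).
    apply/setP=> y; rewrite !inE; case: eqP => [->|_] /=; first by rewrite wB.
    by case: eqP => [->|_] //=; rewrite (negPf aB) andbF.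
  by rewrite cardsU1 !inE (negPf wX) /=; lia.
- have -> : (w |: (a |: X)) :&: A = a |: (X :&: A).
    apply/setP=> y; rewrite !inE; case: eqP => [->|_] /=.
      by rewrite (negPf wA) andbF orbF; apply/esym/negbTE; apply: contraNneq wA => ->.
    by case: eqP => [->|_] //=.
  by rewrite cardsU1 !inE (negPf aX) /=; lia.
exists [:: w, a & p]; split=> //=.
- by rewrite exw ewa.
- by rewrite sp.
- rewrite up !inE negb_or andbT -andbA; apply/and3P; split.
  + by apply: contraNneq wA => ->.
  + by apply/negP => /pX; rewrite !inE eqxx andbF.
  + by apply/negP => /pX; rewrite !inE eqxx orbT andbF.
- move=> y; rewrite !inE => /or3P[/eqP->|/eqP->|/pX].
  + by rewrite wB orbT.
  + by rewrite aA.
  + by rewrite !inE !negb_or => /andP[-> /and3P[]].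
Qed.

(** The cycle runs from [v] back along [p] to [x], then along [q] to [v]. *)
Lemma has_cycle_two_arms (v x : T) (p q : seq T) :
  path e x p -> path e x q -> uniq (x :: p ++ q) -> v \notin x :: p ++ q ->
  e v (last x p) -> e v (last x q) -> (0 < size p + size q)%N ->
  has_cycle e (size p + size q).+2.
Proof.
move=> pp pq; rewrite -cat_cons => u nv vp vq sz; split; first by lia.
have perm : perm_eq (rev (x :: p) ++ q) ((x :: p) ++ q) by rewrite perm_cat2r perm_rev.
exists (v :: rev (x :: p) ++ q); split.
  by rewrite /= size_cat size_rev /= addSn.
rewrite /ucycle cons_uniq (perm_uniq perm) u (perm_mem perm) nv andbT /=.
rewrite lastI rev_rcons /= vp rcons_path cat_path last_cat.
have -> : last (last x p) (rev (belast x p)) = x.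
  by case: (p) => //= y r; rewrite rev_cons last_rcons.
rewrite pq [e (last _ _) _]e_sym vq !andbT rev_path.
by rewrite (eq_path (e' := e)) // => y z; rewrite e_sym.
Qed.

(** Restart at the last visit to [Z], then cut out repetitions. *)
Lemma last_exit (f : rel T) (Z : {set T}) (x : T) (p : seq T) :
  path f x p -> x \in Z ->
  exists x' p', [/\ x' \in Z, path f x' p', last x' p' = last x p,
    uniq (x' :: p') & {in p', forall y, y \notin Z}].
Proof.
have [m] := ubnP (size p); elim: m x p => // m IHm x p; rewrite ltnS => szp pp xZ.
have [/hasP[y yp yZ]|/hasPn pZ] := boolP (has [in Z] p); last first.
  case/shortenP: pp => p' pp' up' /allP sp'; exists x, p'; split=> // y yp'.
  by apply/pZ/(allP sp')/allP.
case/splitPr: yp szp pp => p1 p2; rewrite size_cat /= => szp.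
rewrite cat_path last_cat /= => /and3P[_ _ pp2].
by apply: IHm => //; lia.
Qed.

(** Each step of the path has at most one end in [B]; summing over the steps counts every position
    twice, except the first and the last. *)
Lemma count_no_two_consecutive (f : rel T) (B : {set T}) x p :
  (forall y z, f y z -> (y \notin B) || (z \notin B)) -> path f x p ->
  (2 * count [in B] (x :: p) <= size p + (x \in B) + (last x p \in B))%N.
Proof.
move=> nBB; elim: p x => [|y p IHp] x /=; first by case: (x \in B).
case/andP=> /nBB fxy /IHp /=; move: fxy; case: (x \in B); case: (y \in B) => //= _; lia.
Qed.

(** * Connected dense pairs *)

(* The summand 1 counts the edge from [u] to the vertex [v], which is kept     *)
(* outside [B].                                                               *)
Local Notation weight A B := (\sum_(u in A) (deg A u + deg B u + 1))%N.

(** Descent on [#|A| + #|B|]: if [A] meets two components, one of them splits the weight exactly,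
    while the threshold is superadditive, so one half is a smaller dense pair. *)
Lemma connected_dense_pair (v : T) :
  (#|T| ^ 2 < 4 * \sum_(u | e v u) deg [set: T] u)%N ->
  exists A B : {set T},
  [/\ {in A, forall u, e v u}, v \notin A :|: B, [disjoint A & B],
      (0 < \sum_(u in A) deg A u)%N & (#|T| * (#|A| + #|B|) < 4 * weight A B)%N /\
      {in A &, forall x y, connect (inner_edge e A B) x y}].
Proof.
move=> densT; set n := #|T| in densT *.
pose F m := maxn (n * m) (m.+1 ^ 2).
suff: forall A B : {set T}, {in A, forall u, e v u} -> v \notin A :|: B ->
    [disjoint A & B] -> (F (#|A| + #|B|) < 4 * weight A B)%N ->
    exists A B : {set T},
    [/\ {in A, forall u, e v u}, v \notin A :|: B, [disjoint A & B],
        (F (#|A| + #|B|) < 4 * weight A B)%N &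
        {in A &, forall x y, connect (inner_edge e A B) x y}].
  pose A := [set u | e v u]; pose B := ~: (v |: A).
  have vA : v \notin A by rewrite inE e_irr.
  case/(_ A B) => [u||||A1 [B1 [vA1 vB1 dAB dens conn]]].
  - by rewrite inE.
  - by rewrite !inE e_irr eqxx.
  - rewrite disjoint_sym; apply/pred0P => u /=; rewrite !inE.
    by case: (e v u); rewrite ?orbT ?andbF.
  - have -> : weight A B = \sum_(u | e v u) deg [set: T] u.
      apply: eq_big => u; first by rewrite inE.
      rewrite inE => evu; rewrite (deg_inID [set: T] A) setTI -addnA; congr addn.
      rewrite !deg_inE [RHS](big_setD1 v) ?inE ?e_irr //= e_sym evu addnC; congr addn.
      by apply: eq_bigl => y; rewrite !inE negb_or andbT.
    (* Only [v] is left out, so the quadratic term of [F] is exactly [n ^ 2]. *)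
    have cAB : (#|A| + #|B|).+1 = n.
      by rewrite /n -(cardsC (v |: A)) cardsU1 vA -/B add1n addSn.
    rewrite /F cAB gtn_max densT andbT; nia.
  exists A1, B1; split=> //; last by split=> //; apply: leq_ltn_trans dens; rewrite leq_maxl.
  (* Without edges inside [A1] the weight is at most [#|A1| * (#|B1| + 1)], and AM-GM contradicts
     the quadratic term. *)
  rewrite lt0n; apply/eqP => edge0; move: dens; rewrite gtn_max => /andP[_].
  under eq_bigr do rewrite -addnA; rewrite big_split /= edge0 add0n.
  rewrite big_split /= sum1_card.
  have : (\sum_(u in A1) deg B1 u <= #|A1| * #|B1|)%N.
    rewrite -sum_nat_const; apply: leq_sum => u _; apply: subset_leq_card.
    by apply/subsetP => y; rewrite inE => /andP[].
  have := (nat_AGM2 #|A1| #|B1|.+1).1.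
  rewrite mulnS -addnS; lia.
move=> A B; have [m] := ubnP (#|A| + #|B|).
elim: m A B => // m IHm A B; rewrite ltnS => le_m vA vAB dAB dens.
have [/existsP[x /andP[xA /existsP[y /andP[yA nxy]]]]|nconn] :=
  boolP [exists x, (x \in A) && [exists y, (y \in A) && ~~ connect (inner_edge e A B) x y]];
    last first.
  exists A, B; split=> // x y xA yA; apply: contraR nconn => nxy.
  by apply/existsP; exists x; rewrite xA; apply/existsP; exists y; rewrite yA.
pose C := [set z | connect (inner_edge e A B) x z].
have xC : x \in C by rewrite inE connect0.
have yC : y \notin C by rewrite inE.
have closedC u w : inner_edge e A B u w -> (u \in C) = (w \in C).
  have fsym : symmetric (inner_edge e A B).
    by move=> p q; rewrite /inner_edge e_sym [(p \in A) || _]orbC; congr andb; exact: andbCA.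
  move=> uw; rewrite !inE; apply/idP/idP => h; apply: connect_trans h _; apply: connect1 => //.
  by rewrite fsym.
clearbody C.
have inC u (S : {set T}) : u \in A -> S \subset A :|: B ->
    deg S u = deg (if u \in C then S :&: C else S :\: C) u.
  move=> uA /subsetP sS; apply: eq_card => w; rewrite !inE.
  have [euw|] := boolP (e u w); last by rewrite !andbF.
  have [wS|wS] := boolP (w \in S); last by case: ifP; rewrite !inE (negPf wS) ?andbF.
  have /closedC uwC : inner_edge e A B u w.
    by rewrite /inner_edge euw uA (sS _ wS) inE uA.
  by case: ifP; rewrite !inE wS -uwC => ->.
have cA := cardsID C A; have cB := cardsID C B.
have xAC : (0 < #|A :&: C|)%N by rewrite card_gt0; apply/set0Pn; exists x; rewrite inE xA.
have yAC : (0 < #|A :\: C|)%N by rewrite card_gt0; apply/set0Pn; exists y; rewrite inE yA yC.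
have splitW : weight A B = (weight (A :&: C) (B :&: C) + weight (A :\: C) (B :\: C))%N.
  rewrite (big_setID C) /=; congr addn; apply: eq_bigr => u; rewrite !inE.
    by case/andP=> uA uC; rewrite (inC u A) ?subsetUl // (inC u B) ?subsetUr // uC.
  by case/andP=> uC uA; rewrite (inC u A) ?subsetUl // (inC u B) ?subsetUr // (negPf uC).
have ltn : (#|A| + #|B| < n)%N.
  rewrite /n -(cardsC (A :|: B)) cardsU disjoint_setI0 // cards0 subn0 -addn1 leq_add2l.
  by rewrite card_gt0; apply/set0Pn; exists v; rewrite inE.
have subD (P : {set T} -> {set T}) :
    (forall S, P S \subset S) -> (#|P A| + #|P B| < #|A| + #|B|)%N ->
    (F (#|P A| + #|P B|) < 4 * weight (P A) (P B))%N ->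
    exists A B : {set T},
    [/\ {in A, forall u, e v u}, v \notin A :|: B, [disjoint A & B],
        (F (#|A| + #|B|) < 4 * weight A B)%N &
        {in A &, forall x y, connect (inner_edge e A B) x y}].
  move=> sP ltP densP; apply: IHm densP; first exact: leq_trans ltP le_m.
  - by move=> u /(subsetP (sP A)) /vA.
  - by apply: contra vAB; apply/subsetP/setUSS.
  - exact: disjointWl (sP A) (disjointWr (sP B) dAB).
have [d1|d1] := ltnP (F (#|A :&: C| + #|B :&: C|)) (4 * weight (A :&: C) (B :&: C)).
  by apply: (subD (fun S => S :&: C)) => // [S|]; [apply: subsetIl | lia].
have [d2|d2] := ltnP (F (#|A :\: C| + #|B :\: C|)) (4 * weight (A :\: C) (B :\: C)).
  by apply: (subD (fun S => S :\: C)) => // [S|]; [apply: subsetDl | lia].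
suff: (F (#|A :&: C| + #|B :&: C|) + F (#|A :\: C| + #|B :\: C|) <= F (#|A| + #|B|))%N.
  by move: dens; rewrite splitW; lia.
have -> : (#|A| + #|B|)%N = (#|A :&: C| + #|B :&: C| + (#|A :\: C| + #|B :\: C|))%N by lia.
by apply: threshold_superadd; lia.
Qed.

(** * Assembling a cycle of prescribed length *)

(** For average degree below 2 a single edge serves as a degenerate cycle of size 2: only arcs of
    [z] are used later, and an edge has arcs with one and with two vertices. *)
Lemma long_cycle_of_avg_deg (A : {set T}) :
  (0 < \sum_(u in A) deg A u)%N ->
  exists z, [/\ ucycle e z, {subset z <= A} &
    (maxn 2 ((\sum_(u in A) deg A u) %/ #|A|) <= size z)%N].
Proof.
move=> D_gt0; set D := \sum_(u in A) _ in D_gt0 *.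
have A_gt0 : (0 < #|A|)%N.
  rewrite card_gt0; apply: contraTneq D_gt0 => A0.
  by rewrite /D A0 big_set0.
have [d_gt1|d_le1] := ltnP 1 (D %/ #|A|).
  have dA : (D %/ #|A| * #|A| <= D)%N := leq_divM _ _.
  have [||z [uz sz zA]] := @long_cycle_of_sum_deg (D %/ #|A|).-1 A.
  - lia.
  - by rewrite -/D; move: dA; case: (D %/ #|A|) d_gt1 => // d _; rewrite mulSn /=; lia.
  - by exists z; split=> //; lia.
have [u uA du] : exists2 u, u \in A & (0 < deg A u)%N.
  apply/exists_inP; apply: contraTT D_gt0 => /exists_inPn du; rewrite -eqn0Ngt /D.
  by rewrite big1 // => u /du; rewrite -eqn0Ngt => /eqP.
move: du; rewrite card_gt0 => /set0Pn[w].
rewrite inE => /andP[wA euw].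
exists [:: u; w]; split; last by rewrite geq_max /=; lia.
  by rewrite /ucycle /= euw e_sym euw inE; case: eqP euw => // ->; rewrite e_irr.
by move=> y; rewrite !inE => /orP[]/eqP->.
Qed.

Lemma has_cycle_of_degree_sum (v : T) (l : nat) :
  (#|T| ^ 2 < 4 * \sum_(u | e v u) deg [set: T] u)%N ->
  (2 < l)%N -> (4 * l + 4 <= #|T|)%N -> has_cycle e l.
Proof.
move=> densT l_gt2 le_l.
have [A [B [vA vAB dAB D_gt0 [dens conn]]]] := connected_dense_pair densT.
have [z [uz zA]] := long_cycle_of_avg_deg D_gt0.
set D := \sum_(u in A) deg A u in D_gt0 *; set d := (D %/ #|A|)%N.
set n := #|T| in dens le_l; set N := maxn 2 d => le_N.
have eAB x y : inner_edge e A B x y -> e x y by case/and4P.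
have vnA x : x \in A -> x != v.
  by apply: contraTneq => ->; move: vAB; rewrite inE negb_or => /andP[].
have vnAB x : x \in A :|: B -> x != v by apply: contraTneq => ->.
have nBA x : x \in A -> x \notin B by move=> xA; rewrite (disjointFr dAB).
have arms x j : x \in z -> (j.+1 <= size z)%N -> exists q,
    [/\ path e x q, size q = j, uniq (x :: q) & {subset q <= z}].
  move=> xz ltj; case: (rot_to xz) => i z' rz; exists (take j z').
  have := uz; rewrite -(rot_ucycle i) rz => /andP[/= pz /andP[xz' uz']].
  have szz : size z = (size z').+1 by rewrite -(size_rot i) rz.
  have sub : {subset take j z' <= z'} by apply: mem_take.
  split.
  - by apply: take_path; move: pz; rewrite rcons_path => /andP[].
  - by rewrite size_takel // -ltnS -szz.
  - by rewrite /= take_uniq // andbT; apply: contra xz' => /sub.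
  - by move=> y /sub yz'; rewrite -(mem_rot i) rz inE yz' orbT.
have [k_le|k_gt] := leqP l.-1 (size z).
  have [x xz] : exists x, x \in z.
    by case: (z) k_le => [/=|x ? _]; [lia | exists x; rewrite mem_head].
  have [|q [pq sq uq qz]] := arms x l.-2 xz; first by lia.
  have qA y : y \in x :: q -> y \in A by rewrite inE => /predU1P[->|/qz]; apply: zA.
  have -> : l = (size (@nil T) + size q).+2 by rewrite sq /=; lia.
  apply: (@has_cycle_two_arms v x) => //=; rewrite ?sq; last by lia.
  - by apply/negP => /qA/vnA; rewrite eqxx.
  - by apply/vA/zA.
  - by apply/vA/qA/mem_last.
(* With [le_l] this gives [4 * d + 8 <= n], so the subtractions in the core threshold are exact. *)
have d_lt : (d < l.-1)%N by lia.
have A_gt0 : (0 < #|A|)%N.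
  by rewrite lt0n; apply: contraTneq D_gt0 => /cards0_eq A0; rewrite /D A0 big_set0.
have ltD : (D < d.+1 * #|A|)%N by rewrite ltn_ceil.
have [|A1 [B1 [sA1 sB1 A1n0 degA1 degB1]]] :=
    @bipartite_core (n - 4 * d - 8) n A B.
  move: dens; rewrite !big_split /= -/D sum1_card.
  set E := \sum_(u in A) _.
  set s := (n - 4 * d - 8)%N; have nE : n = (s + 4 * d + 8)%N by lia.
  (* What [n * #|A|] exceeds the core threshold by pays for the edges inside  *)
  (* [A] and for those to [v].                                                *)
  have nA : (n * #|A| = s * #|A| + 4 * (d * #|A|) + 8 * #|A|)%N.
    by rewrite {1}nE 2!mulnDl mulnA.
  by move: ltD; rewrite mulSn mulnDr nA; lia.
clear densT dens ltD D_gt0; clearbody d.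
have [y yA1] := set0Pn _ A1n0; have yA := subsetP sA1 y yA1.
have [x [p [xz pp lp up pz]]] : exists x p, [/\ x \in z, path (inner_edge e A B) x p,
    last x p = y, uniq (x :: p) & {in p, forall w, w \notin z}].
  have [x xz] : exists x, x \in z.
    by case: (z) le_N => [/=|x ? _]; [lia | exists x; rewrite mem_head].
  case/connectP: (conn x y (zA x xz) yA) => p pp lp.
  have [|x1 [p1 [x1z pp1 lp1 up1 pz1]]] := @last_exit _ [set u in z] _ _ pp.
    by rewrite inE.
  exists x1, p1; split=> //; rewrite ?lp1 //; first by move: x1z; rewrite inE.
  by move=> w /pz1; rewrite inE.
have xA := zA x xz.
have ep : path e x p by apply: sub_path pp.
have pAB w : w \in p -> w \in A :|: B.
  have : all [in A :|: B] p.
    elim: (p) (x) pp => //= w1 p1 IHp x1 /andP[/and4P[_ _ -> _]] /IHp -> //.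
  by move/allP; apply.
have cntB : (2 * count [in B] (x :: p) <= size p)%N.
  have nBB u w : inner_edge e A B u w -> (u \notin B) || (w \notin B).
    by case/and4P=> _ _ _ /orP[]/nBA ->; rewrite ?orbT.
  have := count_no_two_consecutive nBB pp.
  by rewrite lp (negPf (nBA _ xA)) (negPf (nBA _ yA)) !addn0.
have [c_ge|c_lt] := leqP l.-1 (size p).+1.
  (* Long link: [x :: rcons q w] has [l.-1] vertices and works if [w] is in [A]. Otherwise the
     vertex before [w] is in [A], and a second vertex of [z] replaces [w] at the other end. *)
  pose q := take (l - 3) p; pose w := nth x p (l - 3).
  have qw : take l.-2 p = rcons q w.
    have -> : l.-2 = (l - 3).+1 by clear -l_gt2; lia.
    have lt_p : (l - 3 < size p)%N by clear -l_gt2 c_ge; lia.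
    exact: take_nth.
  have [wA|wA] := boolP (w \in A).
    have -> : l = (size (@nil T) + size (rcons q w)).+2.
      by rewrite -qw size_takel /=; clear -l_gt2 c_ge; lia.
    have qp : {subset rcons q w <= p} by rewrite -qw; apply: mem_take.
    apply: (@has_cycle_two_arms v x) => //=; rewrite ?size_rcons //.
    + by rewrite -qw; apply: take_path.
    + rewrite -qw; case/andP: up => xp up; rewrite take_uniq // andbT.
      by apply: contra xp; apply: mem_take.
    + rewrite inE negb_or eq_sym vnA //=; apply/negP => /qp/pAB/vnAB.
      by rewrite eqxx.
    + exact: vA.
    + by rewrite last_rcons vA.
  have qA : last x q \in A.
    have := take_path l.-2 pp; rewrite qw rcons_path => /andP[_ /and4P[_ _ _]].
    by rewrite (negPf wA) orbF.
  have [|a [pa sa ua az]] := arms x 1 xz; first by clear -le_N; lia.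
  have -> : l = (size a + size q).+2 by rewrite sa size_takel; clear -l_gt2 c_ge; lia.
  have qp : {subset q <= p} by apply: mem_take.
  apply: (@has_cycle_two_arms v x) => //; rewrite ?sa //.
  - by apply: take_path.
  - rewrite -cat_cons cat_uniq ua take_uniq; last by case/andP: up.
    rewrite andbT; apply/hasPn => u /qp up'; rewrite inE negb_or; apply/andP; split.
      by apply: contraTneq up' => ->; case/andP: up.
    by apply/negP => /az uz'; have := pz u up'; rewrite uz'.
  - rewrite inE mem_cat !negb_or eq_sym vnA //=; apply/andP; split.
      by apply/negP => /az/zA/vnA; rewrite eqxx.
    by apply/negP => /qp/pAB/vnAB; rewrite eqxx.
  - apply: vA; case/lastP: (a) az => [//|a' u] az.
    by rewrite last_rcons; apply/zA/az; rewrite mem_rcons mem_head.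
  - exact: vA.
have [j [i [j_gt0 le_j ji le_i]]] := split_length d_lt le_l c_lt.
have [|a [pa sa ua az]] := arms x j.-1 xz; first by clear -j_gt0 le_j le_N; lia.
pose X := [set u in x :: a ++ p].
have [g [pg sg ug lg gX]] : exists g, [/\ path e y g, size g = i.*2, uniq g,
    last y g \in A1 & {in g, forall u, (u \in A1 :|: B1) && (u \notin X)}].
  have [->|i_gt0] := posnP i; first by exists [::].
  move: le_i; rewrite -[i == 0]negbK -lt0n i_gt0 /= => le_i.
  apply: (@alternating_path A1 B1 ((n - 4 * d - 8) %/ 4) (n %/ 4)) => //.
  - exact: disjointWl sA1 (disjointWr sB1 dAB).
  - by move=> u /degA1; clear; lia.
  - by move=> w /degB1; clear; lia.
  (* The arc of [z] lies in [A], so only the link counts here. *)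
  - have : (#|X :&: B1| <= count [in B] (x :: p))%N.
      rewrite -size_filter; apply: leq_trans (card_size _); apply: subset_leq_card.
      apply/subsetP => u; rewrite !inE mem_cat => /andP[uX /(subsetP sB1) uB].
      rewrite mem_filter /= uB inE /=.
      by case/or3P: uX => [->|/az/zA/nBA|->]; rewrite ?uB ?orbT.
    by clear -cntB le_i; lia.
  - have : (#|X :&: A1| <= j + size p)%N.
      apply: leq_trans (subset_leq_card (subsetIl _ _)) _.
      rewrite cardsE; apply: leq_trans (card_size _) _.
      by rewrite /= size_cat sa; clear -j_gt0; lia.
    by clear -ji le_l l_gt2; lia.
have -> : l = (size a + size (p ++ g)).+2 by rewrite size_cat sa sg; clear -j_gt0 ji l_gt2; lia.
apply: (@has_cycle_two_arms v x) => //.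
- by rewrite cat_path ep lp.
- rewrite catA -cat_cons cat_uniq ug andbT; apply/andP; split; last first.
    by apply/hasPn => u /gX /andP[_]; rewrite inE.
  rewrite -cat_cons cat_uniq ua; move: up; rewrite cons_uniq => /andP[xp ->]; rewrite andbT.
  apply/hasPn => u up'; rewrite inE negb_or; apply/andP; split.
    by apply: contraTneq up' => ->.
  by apply/negP => /az uz'; have := pz u up'; rewrite uz'.
- rewrite inE !mem_cat !negb_or eq_sym vnA //=; apply/and3P; split.
  + by apply/negP => /az/zA/vnA; rewrite eqxx.
  + by apply/negP => /pAB/vnAB; rewrite eqxx.
  + apply/negP => /gX /andP[+ _]; move/(subsetP (setUSS sA1 sB1))/vnAB.
    by rewrite eqxx.
- apply: vA; case/lastP: (a) az => [//|a' u] az.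
  by rewrite last_rcons; apply/zA/az; rewrite mem_rcons mem_head.
- by rewrite last_cat lp; apply/vA/(subsetP sA1).
- by rewrite size_cat sa sg; clear -ji c_lt j_gt0; lia.
Qed.

End Graph.

(* From the spectral radius to degree sums *)
From mathcomp Require Import classical_sets.

Local Open Scope ring_scope.

(** The triangle inequality gives [le_f] for eigenvalues of either sign; apply it at [v], then at
    each neighbour of [v], and bound every entry by [f v]. *)
Lemma sqr_eigenvalue_le (R : realType) (T : finType) (e : rel T) (x : R) :
  symmetric e -> eigenvalue (adjacency_mx R e) x ->
  exists v, x ^+ 2 <= (\sum_(u | e v u) deg_in e [set: T] u)%N%:R.
Proof.
move=> e_sym /eigenvalueP[y yA y0].
pose f t := `|y 0 (enum_rank t)|.
have le_f t : `|x| * f t <= \sum_(u | e t u) f u.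
  have := congr1 (fun M : 'rV_ _ => `|M 0 (enum_rank t)|) yA.
  rewrite !mxE normrM => <-; apply: le_trans (ler_norm_sum _ _ _) _.
  rewrite (reindex_onto enum_rank enum_val) => [|i _]; last exact: enum_valK.
  rewrite [leRHS]big_mkcond; under eq_bigl do rewrite enum_rankK eqxx.
  apply: ler_sum => u _; rewrite mxE !enum_rankK e_sym normrM.
  by case: (e t u); rewrite ?normr1 ?mulr1 // normr0 mulr0.
have [t0 ft0] : exists t, 0 < f t.
  case/rV0Pn: y0 => j yj; exists (enum_val j).
  by rewrite /f enum_valK normr_gt0.
pose v := [arg max_(t > t0) f t]%O.
have max_v t : f t <= f v by rewrite /v; case: arg_maxP => // u _; apply.
have fv_gt0 : 0 < f v := lt_le_trans ft0 (max_v t0).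
exists v; rewrite -(ler_pM2r fv_gt0) -real_normK ?num_real // expr2 -mulrA.
apply: le_trans (ler_wpM2l (normr_ge0 x) (le_f v)) _.
rewrite mulr_sumr natr_sum mulr_suml; apply: ler_sum => u _.
apply: le_trans (le_f u) _; rewrite mulr_natl -sumr_const.
rewrite [leLHS]big_mkcond [leRHS]big_mkcond; apply: ler_sum => w _.
by rewrite !inE; case: ifP => // _; apply: max_v.
Qed.

Theorem theorem1p9 (R : realType) (eps : R) (eps_gt0 : 0 < eps)
    (eps_lt : eps < 1 / 4) :
  exists N : nat, forall (n : nat) (T : finType) (e : rel T),
    symmetric e -> irreflexive e ->
    #|T| = n -> (N <= n)%N ->
    Num.sqrt ((n ^ 2 %/ 4)%N%:R : R) < spectral_radius R e ->
    forall l : nat, (3 <= l)%N -> l%:R <= (1 / 4 - eps) * n%:R ->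
      has_cycle e l.
Proof.
(* This bound gives [eps * n >= 1], so [l <= n / 4 - 1], that is [4 * l + 4 <= n]. *)
exists (Num.bound eps^-1) => n T e e_sym e_irr cT le_n lt_rho l l_ge3 le_l.
have [x eig_x lt_x] : exists2 x : R,
    eigenvalue (adjacency_mx R e) x & Num.sqrt ((n ^ 2 %/ 4)%N%:R : R) < x.
  move: lt_rho; rewrite /spectral_radius.
  case: (eqVneq [set x : R | eigenvalue (adjacency_mx R e) x]%classic set0) => [->|/set0P ne].
    by rewrite sup0 ltNge sqrtr_ge0.
  by case/(sup_gt ne) => x eig_x lt_x; exists x.
have [v le_v] := sqr_eigenvalue_le e_sym eig_x.
have lt_v : (n ^ 2 %/ 4 < \sum_(u | e v u) deg_in e [set: T] u)%N.
  rewrite -(ltr_nat R); apply: lt_le_trans le_v.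
  rewrite -[ltLHS]sqr_sqrtr ?ler0n // ltr_pXn2r ?nnegrE ?sqrtr_ge0 //.
  exact: le_trans (sqrtr_ge0 _) (ltW lt_x).
(* The degree sum is an integer, so exceeding the floor of [n ^ 2 / 4] means exceeding [n ^ 2 / 4]
   itself. *)
apply: (has_cycle_of_degree_sum e_sym e_irr (v := v)) => //; rewrite cT; first by lia.
have n_ge : eps^-1 <= n%:R.
  apply: le_trans (ltW (archi_boundP _)) _; first by rewrite invr_ge0 ltW.
  by rewrite ler_nat.
have : 1 <= eps * n%:R by rewrite mulrC -ler_pdivrMr // mul1r.
rewrite -(ler_nat R) natrD natrM; move: le_l; rewrite mulrBl; lra.
Qed.
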